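(* If $u$ and $v$ are adjacent vertices of a graph $G$, then $\gamma(G_{u,v,3}) = \gamma(G)+1$.
   Context: Graphs are finite and simple. $\gamma(H)$ denotes the domination number of a graph $H$. For distinct vertices $u,v$ of $G$, $G_{u,v,3}$ is the graph obtained from $G$ by adding three new vertices $x_1,x_2,x_3$ and the edges $ux_1$, $x_1x_2$, $x_2x_3$, $x_3v$ (the edge $uv$ of $G$, if present, is kept). *)

(* Defs.v *)
From mathcomp Require Import all_boot.

Set Implicit Arguments.
Unset Strict Implicit.
Unset Printing Implicit Defensive.

Record sgraph := SGraph {
  vertex :> finType;
  adj : rel vertex;
  adj_sym : symmetric adj;
  adj_irrefl : irreflexive adj
}.

Definition dominating (G : sgraph) (D : {set G}) : bool :=
  [forall x : G, (x \in D) || [exists y in D, adj y x]].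

(* [set: G] is always dominating, so the minimum is over a nonempty family. *)
Definition domination_number (G : sgraph) : nat :=
  #|[arg min_(D < [set: G] | dominating D) #|D| ]|.

Section AddPath3.
Variables (G : sgraph) (u v : G).

(* inl a is the vertex a of G; inr 0, inr 1, inr 2 are x_1, x_2, x_3. *)
Definition add_path3_adj : rel (G + 'I_3) := fun x y =>
  match x, y with
  | inl a, inl b => adj a b
  | inl a, inr i | inr i, inl a =>
      (a == u) && (i == 0 :> nat) || (a == v) && (i == 2 :> nat)
  | inr i, inr j => (j == i.+1 :> nat) || (i == j.+1 :> nat)
  end.

Lemma add_path3_sym : symmetric add_path3_adj.
Proof. by move=> [a|i] [b|j] //=; [apply: adj_sym | rewrite orbC]. Qed.

Lemma add_path3_irrefl : irreflexive add_path3_adj.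
Proof.
by move=> [a|i] /=; [apply: adj_irrefl | rewrite orbb -[_ == _]negbK neq_ltn leqnn].
Qed.

(* The graph G_{u,v,3}, meant for u != v. *)
Definition add_path3 : sgraph := SGraph add_path3_sym add_path3_irrefl.

End AddPath3.

(* Main.v *)
(* If D dominates G then D together with x_2 dominates G_{u,v,3}. Conversely,
   let D dominate G_{u,v,3}, let A be its trace on G and S its trace on
   {x_1, x_2, x_3}; S is nonempty because x_2 is dominated. If u or v lies in A,
   then A dominates G, as u and v are adjacent and only they can be dominated
   from S. Otherwise x_1 and x_3 are dominated from S, so either S = {x_2} and
   A dominates G, or |S| >= 2 and A together with u dominates G. *)
Require Import Defs.
From mathcomp Require Import all_boot.

Lemma dominatingP (G : sgraph) (D : {set G}) :
  reflect (forall x, x \in D \/ exists2 y, y \in D & adj y x) (dominating D).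
Proof.
apply: (iffP forallP) => H x; last first.
  by have [->//|/exists_inP->] := H x; rewrite orbT.
by have /orP[|/exists_inP] := H x; [left|right].
Qed.

Lemma domination_number_le (G : sgraph) (D : {set G}) :
  dominating D -> domination_number G <= #|D|.
Proof.
have domT : dominating [set: G] by apply/dominatingP=> x; left; rewrite inE.
by rewrite /domination_number; case: arg_minnP => // M _; apply.
Qed.

Lemma domination_number_attained (G : sgraph) :
  exists2 D : {set G}, dominating D & #|D| = domination_number G.
Proof.
have domT : dominating [set: G] by apply/dominatingP=> x; left; rewrite inE.
by rewrite /domination_number; case: arg_minnP => // M domM _; exists M.
Qed.

(** Used to count a vertex set of [add_path3 u v] by its traces on [G] and on the new path. *)
Lemma card_set_sum (T1 T2 : finType) (D : {set T1 + T2}) :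
  #|D| = #|inl @^-1: D| + #|inr @^-1: D|.
Proof.
rewrite -!sum1_card big_sumType /=.
by congr (_ + _); apply: eq_bigl => x; rewrite inE.
Qed.

Lemma domination_number_add_path3_le (G : sgraph) (u v : G) :
  domination_number (add_path3 u v) <= domination_number G + 1.
Proof.
have [D /dominatingP domD <-] := domination_number_attained G.
pose x2 : 'I_3 := inord 1.
have x2E : x2 = 1 :> nat by rewrite inordK.
pose D' : {set add_path3 u v} :=
  [set x | match x with inl a => a \in D | inr i => i == x2 end].
suff /domination_number_le : dominating D'.
  rewrite card_set_sum; set A := inl @^-1: _; set S := inr @^-1: _.
  have -> : A = D by apply/setP=> a; rewrite !inE.
  have -> : S = [set x2] by apply/setP=> a; rewrite !inE.
  by rewrite cards1.
apply/dominatingP=> -[a|i].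
  have [Da|[b Db ab]] := domD a; first by left; rewrite inE.
  by right; exists (inl b); rewrite ?inE.
have [->|ix2] := eqVneq i x2; first by left; rewrite inE.
right; exists (inr x2); first by rewrite inE.
(* The other two path vertices, with indices 0 and 2, are both adjacent to [x2]. *)
move: ix2; rewrite -val_eqE /= x2E.
by case: i => [[|[|[|]]]].
Qed.

Lemma domination_number_add_path3_ge (G : sgraph) (u v : G) :
  adj u v -> domination_number G + 1 <= domination_number (add_path3 u v).
Proof.
move=> uv; have vu : adj v u by rewrite adj_sym.
have [D /dominatingP domD <-] := domination_number_attained (add_path3 u v).
rewrite card_set_sum; set A := inl @^-1: D; set S := inr @^-1: D.
pose x1 : 'I_3 := @Ordinal 3 0 isT; pose x2 : 'I_3 := @Ordinal 3 1 isT.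
pose x3 : 'I_3 := @Ordinal 3 2 isT.
have ordE (i : 'I_3) : [\/ i = x1, i = x2 | i = x3].
  by case: i => [[|[|[|]]]] // h; [apply: Or31|apply: Or32|apply: Or33];
    apply: val_inj.
(* Only [u] and [v] have neighbours on the path. *)
have domA a : a != u -> a != v -> a \in A \/ exists2 b, b \in A & adj b a.
  move=> /negPf au /negPf av; have [Da|[[b|i] Db]] := domD (inl a).
  - by left; rewrite inE.
  - by right; exists b; rewrite ?inE.
  - by rewrite /= au av.
have S_gt0 : 0 < #|S|.
  apply/card_gt0P; have [D2|[[b|i] Di]] := domD (inr x2).
  - by exists x2; rewrite inE.
  - by rewrite /= !andbF.
  - by exists i; rewrite inE.
have [domGA|ndomA] := boolP (dominating A).
  exact: leq_add (domination_number_le _ _ domGA) S_gt0.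
(* Otherwise [u] would dominate [v] through the edge [uv], and [domA] would cover the remaining
   vertices. *)
have uA : u \notin A.
  apply: contra ndomA => uA; apply/dominatingP=> a.
  have [->|au] := eqVneq a u; first by left.
  have [->|av] := eqVneq a v; last exact: domA.
  by right; exists u.
have vA : v \notin A.
  apply: contra ndomA => vA; apply/dominatingP=> a.
  have [->|av] := eqVneq a v; first by left.
  have [->|au] := eqVneq a u; last exact: domA.
  by right; exists v.
(* The only neighbours of [x1] are [u], now excluded, and [x2]. *)
have S12 : (x1 \in S) || (x2 \in S).
  have [D1|[[b|i] Di]] := domD (inr x1); first by rewrite !inE D1.
    by rewrite /= !(andbF, andbT, orbF) => /eqP bu; rewrite -bu inE Di in uA.
  by case: (ordE i) Di => -> // Di _; rewrite !inE Di orbT.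
have S23 : (x2 \in S) || (x3 \in S).
  have [D1|[[b|i] Di]] := domD (inr x3); first by rewrite !inE D1 orbT.
    by rewrite /= !(andbF, andbT, orbF) => /eqP bu; rewrite -bu inE Di in vA.
  by case: (ordE i) Di => -> // Di _; rewrite !inE Di.
(* If [S] avoided both ends of the path, no vertex of [G] would be dominated from [S], so [A] would
   dominate [G]. *)
have S13 : (x1 \in S) || (x3 \in S).
  apply: contraR ndomA; rewrite negb_or !inE => /andP[n1 n3].
  apply/dominatingP=> a; have [Da|[[b|i] Db]] := domD (inl a).
  - by left; rewrite inE.
  - by right; exists b; rewrite ?inE.
  - case: (ordE i) Db => -> Db; rewrite /= ?andbF //.
      by rewrite Db in n1.
    by rewrite Db in n3.
(* A set meeting all three pairs from [x1], [x2], [x3] misses at most one of them. *)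
have S_gt1 : 1 < #|S|.
  have S2 i j : i != j -> i \in S -> j \in S -> 1 < #|S|.
    by move=> ij iS jS; apply/card_gt1P; exists i, j.
  case/orP: S12 => iS.
    by case/orP: S23; apply: S2 iS.
  by case/orP: S13; apply: S2 iS.
have /domination_number_le : dominating (u |: A).
  apply/dominatingP=> a.
  have [->|au] := eqVneq a u; first by left; rewrite setU11.
  have [->|av] := eqVneq a v; first by right; exists u; rewrite ?setU11.
  have [aA|[b bA ba]] := domA a au av; first by left; rewrite setU1r.
  by right; exists b; rewrite ?setU1r.
(* The vertex [u] costs one element, and the second element of [S] pays for the remaining [+ 1]. *)
rewrite cardsU1 uA add1n => le_A.
by apply: leq_trans (leq_add le_A (leqnn 1)) _; rewrite addSnnS leq_add2l.
Qed.

Theorem theorem7 (G : sgraph) (u v : G) (huv : adj u v) :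
  domination_number (add_path3 u v) = domination_number G + 1.
Proof.
apply/eqP; rewrite eqn_leq domination_number_add_path3_le.
exact: domination_number_add_path3_ge.
Qed.
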